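(* Let $G$ be a connected, regular graph (without loops), and $r$ a positive integer such that $\operatorname{diam}(G) \geq r$. (a) If $r\equiv 0 \pmod{3}$, then $$\frac{e(G^r)}{e(G)}\geq \frac{r+3}{3}-\frac{3}{2(r+3)}.$$ (b) If $r\not\equiv 0 \pmod{3}$, then $$\frac{e(G^r)}{e(G)}\geq \left\lceil \frac{r}{3} \right\rceil.$$
   Context: Graphs here are finite, undirected, with no loops and no multiple edges. $e(G)$ denotes the number of edges of $G$, and $d(x,y)$ denotes the length of a shortest path between $x$ and $y$ in $G$. For a positive integer $r$, the $r$th power $G^r$ of $G$ is the (loopless) graph with vertex set $V(G)$ in which two distinct vertices $x,y$ are adjacent if and only if $d(x,y)\le r$ in $G$. The diameter $\operatorname{diam}(G)$ of a connected graph $G$ is the smallest $r$ for which $G^r$ is complete, i.e. the maximum distance between two vertices of $G$. A graph is regular if all of its vertices have the same degree. *)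

(* Defs.v *)
From HB Require Import structures.
From mathcomp Require Import all_boot all_order all_algebra.

Set Implicit Arguments.
Unset Strict Implicit.
Unset Printing Implicit Defensive.

(* A graph is a finite type T of vertices with an adjacency relation e : rel T. *)
Definition simple_graph (T : finType) (e : rel T) : Prop :=
  symmetric e /\ irreflexive e.

Definition connected_graph (T : finType) (e : rel T) : Prop :=
  forall x y : T, connect e x y.

Definition degree (T : finType) (e : rel T) (x : T) : nat :=
  #|[set y | e x y]|.

Definition regular_graph (T : finType) (e : rel T) : Prop :=
  forall x y : T, degree e x = degree e y.

(* Edges are unordered pairs of vertices. *)
Definition edges (T : finType) (e : rel T) : {set {set T}} :=
  [set [set p.1; p.2] | p : T * T & e p.1 p.2].

Definition num_edges (T : finType) (e : rel T) : nat := #|edges e|.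

Definition has_path (T : finType) (e : rel T) (n : nat) (x y : T) : bool :=
  [exists p : n.-tuple T, [&& path e x p, uniq (x :: p) & last x p == y]].

(* The length of a path (without repeated vertices) is always < #|T|, so the
   range of n is no restriction.  The value #|T| is only taken when x and y
   are not connected, and stands for an infinite distance. *)
Definition dist (T : finType) (e : rel T) (x y : T) : nat :=
  \big[minn/#|T|]_(n < #|T| | has_path e n x y) n.

(* The conjunct connect e x y says that the distance is finite. *)
Definition graph_power (T : finType) (e : rel T) (r : nat) : rel T :=
  [rel x y | [&& x != y, connect e x y & dist e x y <= r]].

Definition diam (T : finType) (e : rel T) : nat :=
  \max_(x : T) \max_(y : T) dist e x y.

(* Main.v *)
Require Import Defs.
From HB Require Import structures.
From mathcomp Require Import all_boot all_order all_algebra zify ring lra.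
Set Implicit Arguments.
Unset Strict Implicit.
Unset Printing Implicit Defensive.

(** Let [d] be the common degree, [n] the number of vertices and [D = d + 1],
    the size of a closed neighbourhood. Counting edges by their ends,
    [2 e(G) = n d], and [2 e(G^r)] is the sum over [x] of [|B(x, r)| - 1], where
    [B(x, r)] is the ball of radius [r]. The theorem is therefore a lower bound
    on the sum of the sizes of the balls.

    Along a geodesic [g 0, g 1, ...] the closed neighbourhoods of
    [g 0, g 3, g 6, ...] are pairwise disjoint. If [3 k < r], then the ball of
    radius [r] around the origin of a geodesic of length [r] contains [k + 1] of
    them; and a vertex from which no such geodesic starts has the whole graph as
    its ball, which is large by the same argument applied to a geodesic
    realizing the diameter. So every ball has at least [(k + 1) D] elements
    ([card_ball_ecc]), which is (b).

    If [r = 3 k], the neighbourhood of [g (3 k)] may stick out of the ball, and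
    some vertices are deficient: their ball has only [(k + 1) D - def v] elements
    for some [def v > 0]. Three facts bound the total deficit.
    - Around a deficient [v] there are at most [D - def v] deficient vertices at
      distance less than [r] ([deficient_crowding]). Indeed, if [g] is a geodesic
      from [v], the closed neighbourhoods of [g 2, g 5, ..., g (3 k - 1)] already
      take [k D] elements of the ball of [v], and they contain none of these
      vertices: from an inner point of the geodesic the whole of it is so close
      that all the [k + 1] neighbourhoods of [g 0, g 3, ..., g (3 k)] fit in the
      ball.
    - Hence a greedy choice of centres, by decreasing deficit, splits the
      deficient vertices into clusters, the one of the centre [v] having total
      deficit at most [(D - def v) def v <= D^2 / 4], with centres at mutual
      distance at least [r] ([greedy_scattered]).
    - Each centre owns the closed neighbourhoods of [g 0, g 3, ...] on a geodesic
      from it, up to a total weight of [(k + 1) / 2] neighbourhoods; for even [k]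
      the last one has weight one half. This is as far as the territories of
      distinct centres stay disjoint, except for the neighbourhoods of weight one
      half. A vertex in [m > 2] of the latter has in its ball the rest of the [m]
      territories and thus a surplus that pays for the sharing ([star_charge]).
    With [K = k + 1], the number of centres is then at most [2 n / (K D)] up to
    the surplus, so the total deficit minus the total surplus is at most
    [n D / (2 K)] ([sum_ball_lower]), and (a) follows. *)

(** * Distances and geodesics *)

Section Distance.

Variables (T : finType) (e : rel T).
Hypothesis e_sym : symmetric e.
Hypothesis e_conn : connected_graph e.

Lemma dist_le_size x p : path e x p -> dist e x (last x p) <= size p.
Proof.
case/shortenP=> p' ep' up' sub_p'.
have szT : size p' < #|T|.
  by have := max_card (mem (x :: p')); rewrite (card_uniqP up').
apply: (@leq_trans (size p')); last first.
  by apply: uniq_leq_size => //; case/andP: up'.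
rewrite /dist -minEnat -leEnat.
apply: (@Order.TotalTheory.bigmin_le_cond _ nat _ _ (Ordinal szT) _
          (fun i : 'I_#|T| => i : nat)).
by apply/existsP; exists (in_tuple p'); rewrite ep' up' eqxx.
Qed.

(** Connectedness rules out the default value [#|T|] of [dist], so distances are
    realized by paths. *)
Lemma dist_path x y :
  exists p, [/\ path e x p, last x p = y & size p = dist e x y].
Proof.
have hasP n : has_path e n x y -> exists p, [/\ path e x p, last x p = y & size p = n].
  by case/existsP=> p /and3P[ep _ /eqP ly]; exists p; rewrite size_tuple.
have [// | dT] : (exists p, [/\ path e x p, last x p = y & size p = dist e x y])
    \/ dist e x y = #|T|.
  rewrite /dist; elim/big_ind: _ => [|m n Hm Hn|n /hasP ?]; [by right| |by left].
  by case: (leqP m n).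
have /connectP[p ep ly] := e_conn x y.
(* A repetition-free path has fewer than [#|T|] edges, so it gives a smaller value. *)
case/shortenP: ep ly => p' ep' up' _ ly.
have := dist_le_size ep'; rewrite -ly dT => szT.
by have := max_card (mem (x :: p')); rewrite (card_uniqP up') ltnNge szT.
Qed.

Lemma dist0 x y : (dist e x y == 0) = (x == y).
Proof.
apply/eqP/eqP => [d0|->]; last by apply/eqP; rewrite -leqn0 (@dist_le_size y [::]).
have [p [_ ly sz]] := dist_path x y; rewrite d0 in sz.
by rewrite -ly (size0nil sz).
Qed.

Lemma dist_tri y x z : dist e x z <= dist e x y + dist e y z.
Proof.
have [p [ep <- <-]] := dist_path x y.
have [q [eq_q <- <-]] := dist_path (last x p) z.
by rewrite -last_cat -size_cat dist_le_size // cat_path ep.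
Qed.

Lemma dist_edge x y : e x y -> dist e x y <= 1.
Proof. by move=> exy; apply: (@dist_le_size x [:: y]); rewrite /= exy. Qed.

Lemma dist_sym x y : dist e x y = dist e y x.
Proof.
suff le a b : dist e b a <= dist e a b by apply/eqP; rewrite eqn_leq !le.
have [p [ep <- <-]] := dist_path a b.
elim/last_ind: p ep => [|p c IHp] /=; first by rewrite leqn0 dist0.
rewrite rcons_path last_rcons size_rcons => /andP[/IHp le_p epc].
apply: leq_trans (dist_tri (last a p) _ _) _.
by rewrite addnC -addn1 leq_add // dist_edge // e_sym.
Qed.

Lemma dist_le1 x y : (dist e x y <= 1) = (x == y) || e x y.
Proof.
apply/idP/orP => [|[/eqP->|/dist_edge//]]; last by rewrite leq_eqVlt ltnS leqn0 dist0 eqxx orbT.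
have [[|z [|? ?]] [/= ep <- <-]] := dist_path x y => // _; first by left.
by right; rewrite andbT in ep.
Qed.

Lemma dist_pred x y n : dist e x y = n.+1 -> exists2 z, dist e x z = n & dist e z y = 1.
Proof.
move=> dxy; have [p [ep ly sz]] := dist_path x y.
rewrite dxy in sz; case/lastP: p ep ly sz => [//|p c].
rewrite rcons_path last_rcons size_rcons => /andP[ep epc] cy [szp].
rewrite {c}cy in epc; have := dist_le_size ep; have := dist_edge epc.
have := dist_tri (last x p) x y; rewrite dxy szp => *; exists (last x p); lia.
Qed.

Definition geodesic r g := forall i j, i <= j -> j <= r -> dist e (g i) (g j) = j - i.

Lemma geodesicP x y r : r <= dist e x y -> exists2 g : nat -> T, g 0 = x & geodesic r g.
Proof.
suff geo n z : dist e x z = n -> exists g : nat -> T, [/\ g 0 = x, g n = z & geodesic n g].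
  move=> le_r; have [g [g0 _ geo_g]] := geo _ y erefl.
  by exists g => // i j ij jr; rewrite geo_g // (leq_trans jr).
elim: n z => [|n IHn] z.
  move/eqP; rewrite dist0 => /eqP <-; exists (fun=> x); split=> // i j ij.
  by rewrite leqn0 => /eqP->; rewrite sub0n; apply/eqP; rewrite dist0.
move=> dz; have [y' dy' y'z] := dist_pred dz.
have [g [g0 gn geo]] := IHn _ dy'.
exists (fun i => if i <= n then g i else z); split; rewrite ?ltnn //.
move=> i j ij jn; case: (leqP j n) => [jn'|nj]; first by rewrite (leq_trans ij jn') geo.
case: leqP => [le_in|ni]; last first.
  by rewrite (_ : j - i = 0); [apply/eqP; rewrite dist0 | lia].
have := dist_tri y' (g i) z; have := dist_tri (g i) x z.
have := geo _ _ (leq0n i) le_in; have := geo _ _ le_in (leqnn n).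
rewrite g0 gn; lia.
Qed.

Definition ball n x := [set y | dist e x y <= n].

Lemma card_ball1 : irreflexive e -> forall x, #|ball 1 x| = (degree e x).+1.
Proof.
move=> e_irr x; rewrite /degree (cardsD1 x) inE dist_le1 eqxx; congr _.+1.
apply: eq_card => y; rewrite !inE dist_le1 eq_sym.
by case: eqP => // ->; rewrite e_irr.
Qed.

Lemma degree_power r x : (degree (graph_power e r) x).+1 = #|ball r x|.
Proof.
rewrite /degree [RHS](cardsD1 x) inE (eqP (_ : dist e x x == 0)) ?dist0 //; congr _.+1.
by apply: eq_card => y; rewrite !inE /graph_power /= eq_sym e_conn.
Qed.

End Distance.

(** * Counting edges *)

Lemma handshake (T : finType) (e : rel T) :
  symmetric e -> irreflexive e -> (num_edges e).*2 = \sum_x degree e x.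
Proof.
move=> e_sym e_irr; pose A := [set p : T * T | e p.1 p.2].
pose h (p : T * T) := [set p.1; p.2].
have ->: \sum_x degree e x = #|A|.
  rewrite -sum1_card (eq_bigl (fun p => e p.1 p.2)) => [|p]; last by rewrite inE.
  rewrite -(pair_big_dep xpredT e (fun _ _ => 1)); apply: eq_bigr => x _.
  by rewrite sum1dep_card.
have fib E : E \in edges e -> #|[set p in A | h p == E]| = 2.
  case/imsetP=> -[a b]; rewrite inE /= => eab ->.
  have neq_ab: a != b by apply: contraTneq eab => ->; rewrite e_irr.
  rewrite (_ : [set p in A | _] = [set (a, b); (b, a)]).
    by rewrite cards2 xpair_eqE negb_and neq_ab.
  apply/setP=> -[c d]; rewrite !inE /= !xpair_eqE /h /=.
  apply/andP/orP=> [[ecd /eqP eqE]|].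
    have neq_cd: c != d by apply: contraTneq ecd => ->; rewrite e_irr.
    have := set22 c d; have := set21 c d; rewrite eqE !inE.
    move=> /orP[]/eqP cE /orP[]/eqP dE; move: neq_cd; rewrite cE dE ?eqxx //.
      by left.
    by right.
  case=> /andP[/eqP-> /eqP->]; split=> //; first by rewrite e_sym.
  by rewrite setUC.
have Aimg: edges e = h @: A.
  by apply/setP=> E; apply/imsetP/imsetP=> -[p ep ->]; exists p; rewrite ?inE // in ep *.
rewrite -[#|A|]sum1_card (partition_big_imset h) /= -Aimg -muln2 -sum_nat_const.
by apply: eq_bigr => E /fib <-; rewrite sum1dep_card; apply: eq_card => p; rewrite !inE.
Qed.

(** * Counting in finite sets *)

Lemma card_sum_mem (T : finType) (A : {set T}) : #|A| = \sum_y (y \in A).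
Proof. by rewrite -sum1_card big_mkcond. Qed.

Lemma sum_card_disjoint (I T : finType) (P : pred I) (F : I -> {set T}) (A : {set T}) :
    (forall i, P i -> F i \subset A) ->
    (forall i j, P i -> P j -> i != j -> [disjoint F i & F j]) ->
  \sum_(i | P i) #|F i| <= #|A|.
Proof.
move=> subA disjF.
rewrite card_sum_mem; under eq_bigr do rewrite card_sum_mem.
rewrite exchange_big /=; apply: leq_sum => y _.
case: (pickP (fun i => P i && (y \in F i))) => [i /andP[Pi yi]|noy]; last first.
  by rewrite big1 // => i Pi; have := noy i; rewrite Pi /= => ->.
rewrite (subsetP (subA i Pi) _ yi) (bigD1 i) //= yi big1 // => j /andP[Pj ji].
by have /pred0P/(_ y) := disjF j i Pj Pi ji; rewrite /= yi andbT => ->.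
Qed.

(** The centres are chosen by decreasing [def]. When [v] is chosen, the remaining
    points related to [v] are discarded: there are at most [D - def v] of them
    and none has a value above [def v], so together they account for at most
    [(D - def v) * def v <= D ^ 2 / 4]. *)
Lemma greedy_scattered (T : finType) (h : rel T) (X : {set T}) (def : T -> nat) (D : nat) :
    reflexive h -> symmetric h ->
    {in X, forall v, def v + #|X :&: [set w | h v w]| <= D} ->
  exists C : {set T}, [/\ C \subset X,
    forall v w, v \in C -> w \in C -> v != w -> ~~ h v w
    & 4 * \sum_(v in X) def v <= #|C| * D ^ 2].
Proof.
move=> h_refl h_sym defX.
suff gr n (Y : {set T}) : #|Y| <= n -> Y \subset X -> exists C : {set T}, [/\ C \subset Y,
    forall v w, v \in C -> w \in C -> v != w -> ~~ h v w
    & 4 * \sum_(v in Y) def v <= #|C| * D ^ 2] by exact: gr (leqnn _) (subxx _).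
elim: n Y => [|n IHn] Y leYn subYX.
  move: leYn; rewrite leqn0 cards_eq0 => /eqP->; exists set0.
  by split=> [|v w|]; rewrite ?sub0set ?inE // big_set0 muln0.
have [->|[v0 v0Y]] := set_0Vmem Y.
  exists set0.
  by split=> [|v w|]; rewrite ?sub0set ?inE // big_set0 muln0.
case: (@arg_maxnP _ v0 (mem Y) def v0Y) => v; rewrite inE => vY max_v.
have vX := subsetP subYX v vY.
pose H := [set w | h v w]; have vH : v \in H by rewrite inE h_refl.
have [||C [subC scatC sumC]] := IHn (Y :\: H).
- have := cardsID H Y; have : 0 < #|Y :&: H| by apply/card_gt0P; exists v; rewrite inE vY.
  lia.
- exact: subset_trans (subsetDl _ _) subYX.
have vC : v \notin C by apply: contraL vH => /(subsetP subC); rewrite inE => /andP[].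
exists (v |: C); split.
- by rewrite subUset sub1set vY (subset_trans subC) ?subsetDl.
- move=> a b /setU1P[->|aC] /setU1P[->|bC]; rewrite ?eqxx //= => neq; last exact: scatC.
    by have := subsetP subC _ bC; rewrite !inE => /andP[].
  by have := subsetP subC _ aC; rewrite !inE => /andP[+ _]; rewrite h_sym.
rewrite cardsU1 vC mulnDl mul1n (big_setID H) /= mulnDr leq_add //.
apply: (@leq_trans (4 * ((D - def v) * def v))).
  rewrite leq_mul2l /=; apply: (@leq_trans (#|Y :&: H| * def v)).
    by rewrite -sum_nat_const leq_sum // => w /setIP[wY _]; apply: max_v.
  rewrite leq_mul2r; apply/orP; right.
  apply: leq_trans (subset_leq_card (setSI H subYX)) _; have defv := defX v vX.
  by rewrite -(leq_add2l (def v)) subnKC // (leq_trans _ defv) ?leq_addr.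
move: (def v) => d.
have [dD|/ltnW/eqP->//] := leqP d D.
by rewrite -{2}(subnK dD) nat_AGM2.
Qed.

(** * Packing closed neighbourhoods along geodesics *)

Section Packing.

Variables (T : finType) (e : rel T) (D : nat).
Hypothesis e_sym : symmetric e.
Hypothesis e_conn : connected_graph e.
Hypothesis D_min : forall x, D <= #|ball e 1 x|.

Let dist_sym := dist_sym e_sym e_conn.
Let dist_tri := dist_tri e_conn.

Lemma packing (f : nat -> T) p (A : {set T}) :
    (forall i, i < p -> ball e 1 (f i) \subset A) ->
    (forall i j, i < j -> j < p -> 2 < dist e (f i) (f j)) ->
  p * D <= #|A|.
Proof.
move=> subA far; rewrite -[p in p * _]card_ord -sum_nat_const.
apply: (@leq_trans (\sum_(i < p) #|ball e 1 (f i)|)); first exact: leq_sum.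
apply: sum_card_disjoint => [i _|i j _ _ neq_ij]; first exact: subA.
have {}far : 2 < dist e (f i) (f j).
  case: (ltngtP i j) => [ij|ji|/val_inj eq_ij]; first exact: far.
    by rewrite dist_sym; apply: far.
  by rewrite eq_ij eqxx in neq_ij.
apply/pred0P=> y /=; rewrite !inE; apply/andP=> -[yi yj].
have := dist_tri y (f i) (f j); rewrite [dist e y _]dist_sym; lia.
Qed.

Lemma geodesic_dist r g i j :
  geodesic e r g -> i <= r -> j <= r -> dist e (g i) (g j) = (i - j) + (j - i).
Proof.
move=> geo ir jr; case: (leqP i j) => [ij|/ltnW ji]; first by rewrite geo //; lia.
by rewrite dist_sym geo //; lia.
Qed.

Lemma geodesic_packing r g a p (A : {set T}) :
    geodesic e r g -> 3 * p + a <= r + 3 ->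
    (forall i, i < p -> ball e 1 (g (3 * i + a)) \subset A) ->
  p * D <= #|A|.
Proof.
move=> geo pr subA; apply: packing subA _ => i j ij jp.
by rewrite (geodesic_dist geo) //; lia.
Qed.

Lemma geodesic_packing_ball r g p s x :
    geodesic e r g -> 3 * p <= r + 3 ->
    (forall i, i < p -> dist e x (g (3 * i)) < s) ->
  p * D <= #|ball e s x|.
Proof.
move=> geo pr near_x; apply: (@geodesic_packing r g 0) => // [|i ip]; first by rewrite addn0.
apply/subsetP=> y; rewrite !inE addn0; have := near_x i ip.
have := dist_tri (g (3 * i)) x y; lia.
Qed.

Lemma card_ball_geodesic r k g :
  geodesic e r g -> 3 * k <= r -> k.+1 * D <= #|ball e (3 * k).+1 (g 0)|.
Proof.
move=> geo kr; apply: (geodesic_packing_ball geo) => [|i ik]; first lia.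
by rewrite (geodesic_dist geo) //; lia.
Qed.

(** Either a geodesic of length [r] starts at [x], or the ball is everything. *)
Lemma card_ball_ecc r k x :
  3 * k < r -> k.+1 * D <= #|T| -> k.+1 * D <= #|ball e r x|.
Proof.
move=> kr cardT.
case: (pickP (fun y => r <= dist e x y)) => [y /(geodesicP e_conn)[g <- geo]|near_x].
  apply: leq_trans (card_ball_geodesic geo (ltnW kr)) _.
  by apply/subset_leq_card/subsetP=> z; rewrite !inE => /leq_trans->.
apply: leq_trans cardT _; rewrite -cardsT; apply/subset_leq_card/subsetP=> z _.
by have := near_x z; rewrite inE; lia.
Qed.

(** * Balls whose radius is a multiple of three *)

Section Multiple_of_three.

Variable k : nat.
Hypothesis k_gt0 : 0 < k.
Hypothesis cardT : k.+1 * D <= #|T|.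

Let r := 3 * k.
Let deficient := [set x | #|ball e r x| < k.+1 * D].

Lemma deficient_geodesic v : v \in deficient -> exists2 g, g 0 = v & geodesic e r g.
Proof.
rewrite inE ltnNge => def_v.
case: (pickP (fun y => r <= dist e v y)) => [y /(geodesicP e_conn)//|near_v].
case/negP: def_v; apply: leq_trans cardT _.
rewrite -cardsT; apply/subset_leq_card/subsetP=> z _.
by have := near_v z; rewrite inE; lia.
Qed.

(** Let [g] be a geodesic of length [r] from [v]. The closed neighbourhoods of
    [g 2, g 5, ..., g (r - 1)] lie in the ball of [v] and contain no deficient
    vertex [w] at distance less than [r] from [v]: such a [w] would be at
    distance less than [r] from all of [g 0, g 3, ..., g r], whose [k + 1]
    closed neighbourhoods would fit in its ball. *)
Lemma deficient_crowding v : v \in deficient ->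
  k * D + #|deficient :&: [set w | dist e v w < r]| <= #|ball e r v|.
Proof.
move=> def_v; have [g g0 geo] := deficient_geodesic def_v.
set N := _ :&: _; have subN : N \subset ball e r v.
  by apply/subsetP=> w; rewrite !inE => /andP[_ /ltnW].
rewrite -[leqRHS](cardsID N) (setIidPr subN) addnC leq_add2l.
apply: (@geodesic_packing r g 2) => // [|i ik]; first by rewrite /r; lia.
apply/subsetP=> w; rewrite 2!inE => wi.
have [i2r ir] : 3 * i + 2 <= r /\ i < k by rewrite /r; lia.
have dv : dist e v (g (3 * i + 2)) = 3 * i + 2 by rewrite -g0 (geodesic_dist geo) //; lia.
have := dist_tri (g (3 * i + 2)) v w; rewrite dv => dvw.
rewrite [w \in ball _ _ _]inE andbC; apply/andP; split; first by rewrite /r; lia.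
rewrite !inE; apply/negP=> /andP[+ near_w]; rewrite ltnNge => /negP[].
apply: (geodesic_packing_ball geo) => [|[|l] lk]; first by rewrite /r; lia.
  by rewrite muln0 g0 dist_sym.
have := dist_tri (g (3 * i + 2)) w (g (3 * l.+1)).
rewrite [dist e w (g (3 * i + 2))]dist_sym (geodesic_dist geo) // /r; lia.
Qed.

Let star p (g : nat -> T) := \bigcup_(i < p) ball e 1 (g (3 * i)).

Lemma starP p g x :
  reflect (exists2 i, i < p & dist e (g (3 * i)) x <= 1) (x \in star p g).
Proof.
apply: (iffP bigcupP) => [[i _]|[i ip ix]]; first by rewrite inE; exists i.
by exists (Ordinal ip); rewrite ?inE.
Qed.

Lemma star_dist p g x : geodesic e r g -> 3 * p <= r + 3 ->
  x \in star p g -> dist e (g 0) x <= 3 * p - 2.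
Proof.
move=> geo pr /starP[i ip ix]; have := dist_tri (g (3 * i)) (g 0) x.
rewrite geo //; lia.
Qed.

Lemma card_star p g : geodesic e r g -> 3 * p <= r + 3 -> p * D <= #|star p g|.
Proof.
move=> geo pr; apply: (@geodesic_packing r g 0) => // [|i ip]; first by rewrite addn0.
by rewrite addn0; apply: (bigcup_sup (Ordinal ip)).
Qed.

(** The stars of sizes [p] and [q] coincide when [k] is odd and differ by one
    neighbourhood when [k] is even. Counting both, each with weight one half,
    gives a territory of weight [(k + 1) / 2] for either parity. The stars have
    radii at most [3 p - 2] and [3 q - 2], whose sum is [r - 1], so the small star
    of a centre does not meet the large star of a centre at distance at least
    [r]. *)
Let p := uphalf k.
Let q := k./2.+1.

(** A vertex in a small star belongs to the territory of one centre only. A vertex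
    that is in no small star but in [m > 2] large ones has in its ball the [m]
    small stars, which are disjoint, and one more closed neighbourhood, around
    the point that puts it in one of the large stars. *)
Lemma star_charge (C : {set T}) (G : T -> nat -> T) x :
    {in C, forall c, G c 0 = c /\ geodesic e r (G c)} ->
    {in C &, forall c c', c != c' -> r <= dist e c c'} ->
  D * (\sum_(c in C) ((x \in star p (G c)) + (x \in star q (G c))))
    <= 2 * D + (#|ball e r x| - k.+1 * D).
Proof.
move=> geoC farC.
have pq : p + q = k.+1 by rewrite /p /q; lia.
have [p_gt0 [le_pq le_qp]] : 0 < p /\ p <= q /\ q <= p.+1 by rewrite /p /q; lia.
have disj c c' y : c \in C -> c' \in C -> c != c' ->
    y \in star p (G c) -> y \notin star q (G c').
  move=> cC c'C neq yc; apply/negP=> yc'; have := farC c c' cC c'C neq.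
  have [Gc geo] := geoC c cC; have [Gc' geo'] := geoC c' c'C.
  have := star_dist geo _ yc; have := star_dist geo' _ yc'; rewrite Gc Gc'.
  have := dist_tri y c c'; rewrite [dist e y _]dist_sym /r; lia.
have sub_pq g y : y \in star p g -> y \in star q g.
  by case/starP=> i ip iy; apply/starP; exists i => //; apply: leq_trans ip _.
case: (pickP (fun c => (c \in C) && (x \in star p (G c)))) => [c /andP[cC xc]|no_p].
  rewrite mulnC; apply: (leq_trans _ (leq_addr _ _)); rewrite leq_mul2r; apply/orP; right.
  rewrite (bigD1 c) //= big1 ?addn0 => [|c' /andP[c'C neq]].
    exact: leq_add (leq_b1 _) (leq_b1 _).
  have xNq : x \notin star q (G c') by apply: disj xc => //; rewrite eq_sym.
  by rewrite (negPf xNq) (negPf (contra (sub_pq _ _) xNq)).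
pose Q := [set c in C | x \in star q (G c)].
have ->: \sum_(c in C) ((x \in star p (G c)) + (x \in star q (G c))) = #|Q|.
  rewrite -sum1_card big_mkcond [RHS]big_mkcond; apply: eq_bigr => c _.
  by rewrite inE; have := no_p c; case: (c \in C) => //= ->; case: ifP.
have [Q2|Q3] := leqP #|Q| 2.
  by apply: leq_trans (leq_addr _ _); rewrite mulnC leq_mul2r Q2 orbT.
have QP c : c \in Q -> [/\ c \in C, x \in star q (G c), G c 0 = c & geodesic e r (G c)].
  by rewrite inE => /andP[cC xc]; have [] := geoC c cC.
have subQ c y : c \in Q -> y \in star p (G c) -> dist e x y <= r.
  case/QP=> cC xc Gc geo yc; have := dist_tri c x y; rewrite [dist e x c]dist_sym.
  have := star_dist geo _ yc; have := star_dist geo _ xc; rewrite Gc /r; lia.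
have [c0 c0Q] : exists c, c \in Q by apply/card_gt0P; lia.
have [c0C xc0 _ geo0] := QP _ c0Q.
have [i0 i0q xi0] := starP _ _ _ xc0.
have p_i0 : p <= i0.
  rewrite leqNgt; apply/negP=> i0p; have := no_p c0; rewrite c0C => /negP[].
  by apply/starP; exists i0.
(* [N] is the extra neighbourhood: it is not part of the small star of [c0]. *)
pose N := ball e 1 (G c0 (3 * i0)).
have disjN c y : c \in Q -> y \in star p (G c) -> y \notin N.
  case/QP=> cC _ Gc geo yc; apply/negP=> yN.
  have [cc0|neq] := eqVneq c c0; last first.
    have /negP[] := disj c c0 y cC c0C neq yc.
    by apply/starP; exists i0; rewrite // inE in yN *.
  rewrite cc0 in yc; have [j jp yj] := starP _ _ _ yc; rewrite inE in yN.
  have := dist_tri y (G c0 (3 * j)) (G c0 (3 * i0)); rewrite [dist e y _]dist_sym.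
  rewrite geo0 /r; lia.
have subN : N \subset ball e r x.
  apply/subsetP=> y; rewrite !inE; have := dist_tri (G c0 (3 * i0)) x y.
  rewrite [dist e x (G _ _)]dist_sym /r; lia.
have : #|Q| * (p * D) + D <= #|ball e r x|.
  rewrite -[leqRHS](cardsID N) (setIidPr subN) addnC leq_add ?D_min // -sum_nat_const.
  apply: (@leq_trans (\sum_(c in Q) #|star p (G c)|)).
    by apply: leq_sum => c /QP[_ _ _ geo]; apply: card_star geo _; rewrite /r; lia.
  apply: sum_card_disjoint => [c cQ|c c' cQ c'Q neq].
    by apply/subsetP=> y yc; rewrite inE (disjN c) //= inE (subQ c).
  have [[cC _ _ _] [c'C _ _ _]] := (QP _ cQ, QP _ c'Q).
  apply/pred0P=> y /=; apply/andP=> -[yc yc'].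
  by have /negP[] := disj c c' y cC c'C neq yc; apply: sub_pq.
have : #|Q| * D + k.+1 * D <= 2 * D + (#|Q| * (p * D) + D).
  have : #|Q| + k.+1 <= 2 + (#|Q| * p + 1) by rewrite -pq; nia.
  rewrite -(leq_pmul2r (_ : 0 < D.+1)) //; nia.
rewrite [D * _]mulnC; lia.
Qed.

(** The total deficit is bounded through the number of centres, and that number
    by double counting: the two stars of a centre comprise [p + q = k + 1]
    neighbourhoods, and a vertex lies in at most two stars, up to its surplus. *)
Lemma sum_ball_lower :
  4 * k.+1 ^ 2 * #|T| * D <= 4 * k.+1 * (\sum_x #|ball e r x|) + 2 * #|T| * D.
Proof.
pose def v := k.+1 * D - #|ball e r v|.
pose exc v := #|ball e r v| - k.+1 * D.
pose h v w := dist e v w < r.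
have [| |v def_v|C [subC farC defC]] := @greedy_scattered T h deficient def D.
- by move=> v; rewrite /h (eqP (_ : dist e v v == 0)) ?(dist0 e_conn) // /r; lia.
- by move=> v w; rewrite /h dist_sym.
- have := deficient_crowding def_v; move: def_v; rewrite inE /def /h; lia.
have /fin_all_exists[G geoG] (c : T) :
    exists g : nat -> T, c \in deficient -> g 0 = c /\ geodesic e r g.
  have [/deficient_geodesic[g g0 geo]|Ndef] := boolP (c \in deficient); first by exists g.
  by exists (fun=> c).
have geoC : {in C, forall c, G c 0 = c /\ geodesic e r (G c)}.
  by move=> c /(subsetP subC)/geoG.
have {}farC : {in C &, forall c c', c != c' -> r <= dist e c c'}.
  by move=> c c' cC c'C /(farC _ _ cC c'C); rewrite /h -leqNgt.
have cardC : D * (#|C| * (k.+1 * D)) <= 2 * #|T| * D + \sum_x exc x.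
  apply: (@leq_trans (\sum_x (2 * D + exc x))); last first.
    by rewrite big_split /= sum_nat_const mulnCA mulnA.
  apply: leq_trans (leq_sum _ (fun x _ => star_charge x geoC farC)).
  rewrite -big_distrr /= leq_mul2l exchange_big /= -sum_nat_const; apply/orP; right.
  apply: leq_sum => c /geoC[_ geo]; rewrite big_split /= -!card_sum_mem.
  have -> : k.+1 = p + q by rewrite /p /q; lia.
  by rewrite mulnDl leq_add // (card_star geo) // /p /q /r; lia.
have sum_def : \sum_(v in deficient) def v = \sum_v def v.
  rewrite [LHS]big_mkcond; apply: eq_bigr => v _.
  by case: ifP => //; rewrite inE /def; lia.
have balance : \sum_x #|ball e r x| + \sum_x def x = #|T| * (k.+1 * D) + \sum_x exc x.
  rewrite -big_split -sum_nat_const -big_split; apply: eq_bigr => v _.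
  rewrite /def /exc /=; lia.
rewrite sum_def in defC; move: defC cardC balance.
move: (\sum_x _) (\sum_x _) (\sum_x _) #|C| #|T| => *; nia.
Qed.

End Multiple_of_three.
End Packing.

(** * Powers of regular graphs *)

Import Order.TTheory GRing.Theory Num.Theory.
Local Open Scope ring_scope.

Lemma diam_attained (T : finType) (e : rel T) r :
  (0 < r)%N -> (r <= diam e)%N -> exists x y, (r <= dist e x y)%N.
Proof.
move=> r_gt0 r_le.
case: (pickP (fun p : T * T => (r <= dist e p.1 p.2)%N)) => [[x y] le_r|far].
  by exists x, y.
suff : (diam e <= r.-1)%N by lia.
apply/bigmax_leqP=> x _; apply/bigmax_leqP=> y _.
by have := far (x, y); rewrite /=; lia.
Qed.

Theorem theorem3 (T : finType) (e : rel T) (r : nat)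
    (e_simple : simple_graph e) (e_connected : connected_graph e)
    (e_regular : regular_graph e)
    (r_gt0 : (0 < r)%N) (r_le_diam : (r <= diam e)%N) :
  ((r = 0 %[mod 3])%N ->
     (num_edges (graph_power e r))%:R / (num_edges e)%:R
       >= (r%:R + 3) / 3 - 3 / (2 * (r%:R + 3)) :> rat)
  /\
  ((r <> 0 %[mod 3])%N ->
     (num_edges (graph_power e r))%:R / (num_edges e)%:R
       >= (Num.ceil (r%:R / 3 : rat))%:~R :> rat).
Proof.
have [e_sym e_irr] := e_simple.
have [x0 [y0 /(geodesicP e_connected)[g _ geo]]] := diam_attained r_gt0 r_le_diam.
pose d := degree e x0; pose D := d.+1; pose n := #|T|.
have D_ball x : (D <= #|ball e 1 x|)%N.
  by rewrite card_ball1 // (e_regular x x0).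
have power_sym : symmetric (graph_power e r).
  move=> x y; rewrite /graph_power /= eq_sym !e_connected.
  by rewrite (dist_sym e_sym e_connected).
have power_irr : irreflexive (graph_power e r) by move=> x; rewrite /graph_power /= eqxx.
have edgesE : ((num_edges e).*2 = n * d)%N.
  rewrite handshake // (eq_bigr (fun=> d)) ?sum_nat_const // => x _.
  exact: e_regular.
have edgesP : ((num_edges (graph_power e r)).*2 + n = \sum_x #|ball e r x|)%N.
  rewrite handshake // -[n]sum1_card -big_split /=; apply: eq_bigr => x _.
  by rewrite -degree_power // addn1.
have d_gt0 : (0 < d)%N.
  have dist01 : dist e (g 0%N) (g 1%N) = 1%N by rewrite geo.
  have /orP[/eqP eq01|e01] : (g 0%N == g 1%N) || e (g 0%N) (g 1%N).
  - by rewrite -dist_le1 // dist01.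
  - by have := dist0 e_connected (g 0%N) (g 1%N); rewrite dist01 eq01 eqxx.
  rewrite /d (e_regular x0 (g 0%N)); apply/card_gt0P; exists (g 1%N).
  by rewrite inE.
have n_gt0 : (0 < n)%N by apply/card_gt0P; exists x0.
have E_gt0 : (0 < num_edges e)%N by rewrite -double_gt0 edgesE muln_gt0 n_gt0.
have cardT k : (3 * k <= r)%N -> (k.+1 * D <= n)%N.
  move=> kr; apply: leq_trans (card_ball_geodesic e_sym e_connected D_ball geo kr) _.
  exact: max_card.
have E_gt0' : 0 < (num_edges e)%:R :> rat by rewrite ltr0n.
split=> [r0|r_neq0].
  have [k rE] : exists k, r = (3 * k)%N by exists (r %/ 3)%N; lia.
  have k_gt0 : (0 < k)%N by lia.
  have := sum_ball_lower e_sym e_connected D_ball k_gt0 (cardT k _).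
  rewrite -rE leqnn -edgesP => /(_ isT); rewrite -/n => bound.
  have {bound} : (2 * k.+1 ^ 2 * num_edges e
            <= 2 * k.+1 * num_edges (graph_power e r) + num_edges e)%N.
    have := edgesE; move: bound; rewrite /D -!muln2; move: (num_edges _) (num_edges _) => a b.
    move: k_gt0 n_gt0; clear; nia.
  rewrite -(ler_nat rat) natrD natrM natrM natrX natrM natrM => bound.
  have k_ge0 : 0 <= k%:R :> rat by rewrite ler0n.
  rewrite -[k.+1%:R]natr1 in bound; rewrite ler_pdivlMr // {1 2}rE natrM.
  (* With [r = 3 k], the bound of the statement is [K - 1 / (2 K)] for [K = k + 1]. *)
  rewrite (_ : _ - _ = k%:R + 1 - (2 * (k%:R + 1))^-1); last first.
    by field; apply/andP; split; apply: lt0r_neq0; lra.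
  rewrite -(ler_pM2l (_ : 0 < 2 * (k%:R + 1))); last lra.
  rewrite [leLHS](_ : _ = 2 * (k%:R + 1) ^+ 2 * (num_edges e)%:R - (num_edges e)%:R); first lra.
  by field; apply: lt0r_neq0; lra.
have [k [kr rk]] : exists k, (3 * k < r)%N /\ (r <= 3 * k.+1)%N by exists (r %/ 3)%N; lia.
have -> : Num.ceil (r%:R / 3 : rat) = k.+1.
  apply: ceil_def; rewrite (_ : Posz k.+1 - 1 = k); last lia.
  rewrite -!pmulrn ltr_pdivlMr // ler_pdivrMr // -!natrM ltr_nat ler_nat; lia.
rewrite ler_pdivlMr // -natrM ler_nat -leq_double.
have : (n * (k.+1 * D) <= \sum_x #|ball e r x|)%N.
  rewrite -sum_nat_const leq_sum // => x _.
  exact: card_ball_ecc (cardT k (ltnW kr)).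
rewrite -edgesP doubleMr edgesE /D; move: n_gt0; clear; nia.
Qed.
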